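(* Let $P\subseteq\mathbb{N}=\{0,1,2,\dots\}$ and $V\subseteq\mathbb{P}=\{1,2,\dots\}$, and let $F^{\mathrm{p,v}}(P,V;x)=\sum_{n\ge0}c_nx^n$ where $c_n$ is the number of Motzkin paths of length $n$ in which every peak occurs at a height in $P$ and every valley occurs at a height in $V$. For $i\ge0$ define \[ C_{1,i}=\begin{cases}\frac{x^2}{1-x^2},& i\notin P,\ i+1\notin V,\\ x^2,& i\notin P,\ i+1\in V,\\ 0,&\text{otherwise},\end{cases}\qquad C_{2,i}=\begin{cases}\frac{x^2}{1-x^2},& i\notin V,\ i-1\notin P,\\ x^2,& i\notin V,\ i-1\in P,\\ 0,&\text{otherwise},\end{cases} \] \[ C_{3,i}=\begin{cases}\frac{x^3}{1-x^2},& i\notin P,\ i+1\notin V,\\ 0,&\text{otherwise}.\end{cases} \] Then \[ F^{\mathrm{p,v}}(P,V;x)=\cfrac{1}{1-x+C_{1,0}-\cfrac{(x+C_{3,0})^2}{1-x+C_{1,1}+C_{2,1}-\cfrac{(x+C_{3,1})^2}{1-x+C_{1,2}+C_{2,2}-\cdots}}}. \]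
   Context: A Motzkin path of length $n$ is a sequence of $n$ steps $U$ ($+1$), $F$ ($0$), $D$ ($-1$) starting and ending at height $0$ and never going below $0$. A peak is an occurrence of the consecutive subword $UD$ and a valley an occurrence of $DU$; the height of a peak or valley is the height at which the corresponding subword begins (i.e. the height just before its first step). An infinite continued fraction denotes the formal power series limit of its finite truncations. *)

(* Defs.v *)
From HB Require Import structures.
From mathcomp Require Import all_boot all_order all_algebra.
From mathcomp Require Import boolp classical_sets.

Set Implicit Arguments.
Unset Strict Implicit.
Unset Printing Implicit Defensive.

Import GRing.Theory Num.Theory.

Local Open Scope ring_scope.

(* Formal power series: sequences of coefficients under the Cauchy product.
   The [Choice] structure required by the algebraic hierarchy is classical. *)
Record fps (R : Type) := Fps { coef_fps :> nat -> R }.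

Lemma fpsP (R : Type) (f g : fps R) : (forall n, f n = g n) <-> f = g.
Proof.
split=> [|-> //]; case: f g => [f] [g] /= fg.
by congr Fps; apply: funext.
Qed.

HB.instance Definition _ (R : Type) := gen_eqMixin (fps R).
HB.instance Definition _ (R : Type) := gen_choiceMixin (fps R).

Section FpsRing.
Variable R : comNzRingType.
Implicit Types f g h : fps R.

Definition fps_zero : fps R := Fps (fun=> 0).
Definition fps_opp f : fps R := Fps (fun n => - f n).
Definition fps_add f g : fps R := Fps (fun n => f n + g n).
Definition fps_one : fps R := Fps (fun n => (n == 0%N)%:R).
Definition fps_mul f g : fps R :=
  Fps (fun n => \sum_(i < n.+1) f i * g (n - i)%N).

Fact fps_addA : associative fps_add.
Proof. by move=> f g h; apply/fpsP => n /=; rewrite addrA. Qed.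
Fact fps_addC : commutative fps_add.
Proof. by move=> f g; apply/fpsP => n /=; rewrite addrC. Qed.
Fact fps_add0 : left_id fps_zero fps_add.
Proof. by move=> f; apply/fpsP => n /=; rewrite add0r. Qed.
Fact fps_addN : left_inverse fps_zero fps_opp fps_add.
Proof. by move=> f; apply/fpsP => n /=; rewrite addNr. Qed.

HB.instance Definition _ :=
  GRing.isZmodule.Build (fps R) fps_addA fps_addC fps_add0 fps_addN.

Definition fps_trunc N f : {poly R} := \poly_(i < N) f i.

Lemma coef_fps_trunc N f n : (n < N)%N -> (fps_trunc N f)`_n = f n.
Proof. by move=> nN; rewrite coef_poly nN. Qed.

Lemma fps_mul_trunc N f g n : (n < N)%N ->
  fps_mul f g n = (fps_trunc N f * fps_trunc N g)`_n.
Proof.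
move=> nN; rewrite coefM; apply: eq_bigr => i _.
rewrite !coef_fps_trunc //; first exact: leq_ltn_trans (leq_subr _ _) nN.
by apply: leq_ltn_trans nN; rewrite -ltnS.
Qed.

Fact fps_mulC : commutative fps_mul.
Proof.
move=> f g; apply/fpsP => n.
by rewrite !(fps_mul_trunc _ _ (ltnSn n)) mulrC.
Qed.

Fact fps_mulA : associative fps_mul.
Proof.
move=> f g h; apply/fpsP => n; pose T := fps_trunc n.+1.
transitivity ((T f * T g * T h)`_n); last first.
  rewrite coefM; apply: eq_bigr => i _.
  by rewrite -fps_mul_trunc // coef_fps_trunc // ltnS leq_subr.
rewrite -mulrA coefM; apply: eq_bigr => i _.
by rewrite -fps_mul_trunc ?ltnS ?leq_subr // coef_fps_trunc.
Qed.

Fact fps_mul1 : left_id fps_one fps_mul.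
Proof.
move=> f; apply/fpsP => n /=; rewrite big_ord_recl /= mul1r subn0.
by rewrite big1 ?addr0 // => i _; rewrite mul0r.
Qed.

Fact fps_mulDl : left_distributive fps_mul fps_add.
Proof.
move=> f g h; apply/fpsP => n /=; rewrite -big_split /=.
by apply: eq_bigr => i _; rewrite mulrDl.
Qed.

Fact fps_one_neq0 : fps_one != fps_zero.
Proof. by apply/eqP => /fpsP/(_ 0%N)/eqP; rewrite /= oner_eq0. Qed.

HB.instance Definition _ := GRing.Zmodule_isComNzRing.Build (fps R)
  fps_mulA fps_mulC fps_mul1 fps_mulDl fps_one_neq0.

Definition fps_X : fps R := Fps (fun n => (n == 1%N)%:R).

Lemma coef_fps0 n : (0 : fps R) n = 0. Proof. by []. Qed.
Lemma coef_fps1 n : (1 : fps R) n = (n == 0%N)%:R. Proof. by []. Qed.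
Lemma coef_fpsD f g n : (f + g) n = f n + g n. Proof. by []. Qed.
Lemma coef_fpsN f n : (- f) n = - f n. Proof. by []. Qed.
Lemma coef_fpsM f g n : (f * g) n = \sum_(i < n.+1) f i * g (n - i)%N.
Proof. by []. Qed.

End FpsRing.

Section FpsUnitRing.
Variable R : comUnitRingType.
Implicit Types f g : fps R.

Definition fps_unit : {pred fps R} := fun f => f 0%N \is a GRing.unit.

(* The first [n] coefficients of the inverse of [f], each one obtained by
   solving the equation (f * f^-1)_m = (m == 0). *)
Fixpoint fps_inv_seq f n : seq R :=
  if n is m.+1 then
    let s := fps_inv_seq f m in
    rcons s ((f 0%N)^-1 * ((m == 0%N)%:R - \sum_(i < m) f i.+1 * s`_(m - i.+1)))
  else [::].

Definition fps_inv f : fps R :=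
  if f \in fps_unit then Fps (fun n => (fps_inv_seq f n.+1)`_n) else f.

Lemma size_fps_inv_seq f n : size (fps_inv_seq f n) = n.
Proof. by elim: n => //= n IHn; rewrite size_rcons IHn. Qed.

Lemma nth_fps_inv_seq f n k : (k < n)%N ->
  (fps_inv_seq f n)`_k = (fps_inv_seq f k.+1)`_k.
Proof.
elim: n => // n IHn; rewrite ltnS leq_eqVlt => /predU1P[-> //|kn].
by rewrite [LHS]/= nth_rcons size_fps_inv_seq kn IHn.
Qed.

Fact fps_mulVx : {in fps_unit, left_inverse 1 fps_inv *%R}.
Proof.
move=> f fU; rewrite mulrC /fps_inv fU; apply/fpsP => n.
rewrite coef_fpsM big_ord_recl subn0 coef_fps1 [X in _ * X + _]/=.
rewrite nth_rcons size_fps_inv_seq ltnn eqxx mulVKr //.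
rewrite -[RHS](subrK (\sum_(i < n) f i.+1 * (fps_inv_seq f n)`_(n - i.+1))).
congr (_ + _); apply: eq_bigr => i _; congr (_ * _).
rewrite [LHS]/= -[LHS]/((fps_inv_seq f (n - i.+1).+1)`_(n - i.+1)).
by rewrite [RHS]nth_fps_inv_seq // ltn_subrL /= (leq_ltn_trans _ (ltn_ord i)).
Qed.

Fact fps_unitPl f g : g * f = 1 -> fps_unit f.
Proof.
move/fpsP/(_ 0%N); rewrite coef_fpsM big_ord1 coef_fps1 subn0 => gf.
by apply/unitrPr; exists (g 0%N); rewrite mulrC.
Qed.

Fact fps_inv_out : {in [predC fps_unit], fps_inv =1 id}.
Proof. by move=> f /negbTE fU; rewrite /fps_inv [f \in _]fU. Qed.

HB.instance Definition _ := GRing.ComNzRing_hasMulInverse.Build (fps R)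
  fps_mulVx fps_unitPl fps_inv_out.

Lemma fps_unitE f : (f \is a GRing.unit) = (f 0%N \is a GRing.unit).
Proof. by []. Qed.

End FpsUnitRing.

Definition fps_cvg (R : Type) (u : nat -> fps R) (f : fps R) : Prop :=
  forall n, exists N, forall m, (N <= m)%N -> u m n = f n.

(* [contfrac_den num den N i] is
   den_i - num_i / (den_(i+1) - num_(i+1) / (... / den_(i+N))). *)
Fixpoint contfrac_den (R : unitRingType) (num den : nat -> R) (N i : nat) : R :=
  if N is M.+1 then den i - num i / contfrac_den num den M i.+1 else den i.

Definition contfrac_trunc (R : unitRingType) (num den : nat -> R) (N : nat) : R :=
  1 / contfrac_den num den N 0.

Definition is_contfrac (R : comUnitRingType) (num den : nat -> fps R)
    (f : fps R) : Prop :=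
  fps_cvg (contfrac_trunc num den) f.

Variant step := Up | Flat | Down.

Definition nat_of_step (s : step) : nat :=
  match s with Up => 0 | Flat => 1 | Down => 2 end.
Definition step_of_nat (n : nat) : option step :=
  match n with 0 => Some Up | 1 => Some Flat | 2 => Some Down | _ => None end.
Fact nat_of_stepK : pcancel nat_of_step step_of_nat. Proof. by case. Qed.

HB.instance Definition _ := Countable.copy step (pcan_type nat_of_stepK).

Fact step_enumP : Finite.axiom [:: Up; Flat; Down]. Proof. by case. Qed.
HB.instance Definition _ := isFinite.Build step step_enumP.

Definition step_val (s : step) : int :=
  match s with Up => 1 | Flat => 0 | Down => -1 end.

(* Height reached after the first [k] steps. *)
Definition height (w : seq step) (k : nat) : int :=
  \sum_(s <- take k w) step_val s.

Definition motzkin (w : seq step) : bool :=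
  all (fun k => 0 <= height w k) (iota 0 (size w).+1)
  && (height w (size w) == 0).

Definition occurs_at (u w : seq step) (k : nat) : bool :=
  take (size u) (drop k w) == u.

(* The heights of a Motzkin path are nonnegative, so that [absz] only casts them
   to [nat]. *)
Definition occurs_at_heights_in (u : seq step) (A : set nat) (w : seq step) :=
  all (fun k => occurs_at u w k ==> (absz (height w k) \in A)) (iota 0 (size w)).

Definition peaks_in : set nat -> seq step -> bool :=
  occurs_at_heights_in [:: Up; Down].
Definition valleys_in : set nat -> seq step -> bool :=
  occurs_at_heights_in [:: Down; Up].

Definition motzkin_pv_count (P V : set nat) (n : nat) : nat :=
  #|[set w : n.-tuple step | [&& motzkin w, peaks_in P w & valleys_in V w]]|.

Definition F_pv (P V : set nat) : fps int :=
  Fps (fun n => (motzkin_pv_count P V n)%:Z).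

Notation "''x'" := (fps_X int) (at level 0) : ring_scope.

Definition C1 (P V : set nat) (i : nat) : fps int :=
  if (i \notin P) && (i.+1 \notin V) then 'x ^+ 2 / (1 - 'x ^+ 2)
  else if (i \notin P) && (i.+1 \in V) then 'x ^+ 2
  else 0.

(* For [i = 0] the integer [i - 1] is not in [P]. *)
Definition C2 (P V : set nat) (i : nat) : fps int :=
  let pred_in_P := (0 < i)%N && (i.-1 \in P) in
  if (i \notin V) && ~~ pred_in_P then 'x ^+ 2 / (1 - 'x ^+ 2)
  else if (i \notin V) && pred_in_P then 'x ^+ 2
  else 0.

Definition C3 (P V : set nat) (i : nat) : fps int :=
  if (i \notin P) && (i.+1 \notin V) then 'x ^+ 3 / (1 - 'x ^+ 2) else 0.

(* Main.v *)
Require Import Defs.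
From HB Require Import structures.
From mathcomp Require Import all_boot all_order all_algebra.
From mathcomp Require Import boolp classical_sets.
From mathcomp Require Import ring.

Set Implicit Arguments.
Unset Strict Implicit.
Unset Printing Implicit Defensive.

Import GRing.Theory Num.Theory.

Local Open Scope ring_scope.

(** Let A_i be the generating function of the allowed excursions above height i,
    a = A_(i+1), and y = x^2 a if i is in P, y = x^2 (a - 1) otherwise, so that y
    counts the arches U w D based at i.  An excursion above i is a word in flat
    steps and arches, without two adjacent arches when i+1 is not in V, so that
    1/A_i = 1 - x - y if i+1 is in V, and 1/A_i = 1 - x - y/(1+y) otherwise.
    In all four cases this reads
      1/A_i = 1 - x + C1_i - (x + C3_i)^2 / (1/A_(i+1) + C2_(i+1)),
    so the series D_0 = 1/A_0 and D_i = 1/A_i + C2_i (i > 0) are the tails of the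
    continued fraction; since its numerators are divisible by x, its truncations
    converge to 1/D_0 = A_0. *)

(** * Congruences modulo powers of [x] and convergence of continued fractions *)

Section FpsCongruence.
Variable R : comUnitRingType.
Implicit Types f g h : fps R.

Lemma coef0_fpsM f g : (f * g) 0%N = f 0%N * g 0%N.
Proof. by rewrite coef_fpsM big_ord1 subn0. Qed.

Lemma coef_fpsXM f n : (fps_X R * f) n = if n is m.+1 then f m else 0.
Proof.
rewrite coef_fpsM big_ord_recl /= mul0r add0r.
case: n => [|n]; first by rewrite big_ord0.
rewrite big_ord_recl /= mul1r subSS subn0 big1 ?addr0 // => i _.
by rewrite mul0r.
Qed.

Lemma coef_fpsMb (c : bool) f n : (c%:R * f) n = if c then f n else 0.
Proof. by case: c; rewrite ?mul1r ?mul0r. Qed.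

Definition fps_eqmod k f g := forall n, (n < k)%N -> f n = g n.

Lemma fps_eqmodMl k h f g : fps_eqmod k f g -> fps_eqmod k (h * f) (h * g).
Proof.
move=> fg n nk; rewrite !coef_fpsM; apply: eq_bigr => i _.
by rewrite fg // (leq_ltn_trans (leq_subr _ _)).
Qed.

(** A factor divisible by [x] gains one coefficient of precision; this drives the convergence. *)
Lemma fps_eqmodMl_coef0 k h f g : h 0%N = 0 ->
  fps_eqmod k f g -> fps_eqmod k.+1 (h * f) (h * g).
Proof.
move=> h0 fg n nk; rewrite !coef_fpsM !big_ord_recl h0 !mul0r !add0r.
apply: eq_bigr => i _; rewrite fg //= -ltnS.
apply: leq_trans nk; rewrite ltnS.
by case: n i => [[]//|n] i; rewrite /= subSS ltnS leq_subr.
Qed.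

(** Multiply the congruence by [f^-1 * g^-1]. *)
Lemma fps_eqmodV k f g : f \is a GRing.unit -> g \is a GRing.unit ->
  fps_eqmod k f g -> fps_eqmod k f^-1 g^-1.
Proof.
move=> fU gU fg n nk; have /(_ n nk) := fps_eqmodMl (f^-1 * g^-1) fg.
by rewrite mulrVK // mulrAC mulVr // mul1r => ->.
Qed.

Lemma is_contfrac_tails (num den D : nat -> fps R) :
    (forall i, num i 0%N = 0) -> (forall i, den i 0%N = 1) ->
    (forall i, D i = den i - num i / D i.+1) ->
  is_contfrac num den (D 0%N)^-1.
Proof.
move=> num0 den0 DE.
have D0 i : D i \is a GRing.unit.
  rewrite DE fps_unitE coef_fpsD coef_fpsN coef0_fpsM num0 mul0r subr0 den0.
  exact: unitr1.
have T0 N i : contfrac_den num den N i \is a GRing.unit.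
  case: N => [|N]; rewrite fps_unitE [contfrac_den _ _ _ _]/=.
    by rewrite den0 unitr1.
  by rewrite coef_fpsD coef_fpsN coef0_fpsM num0 mul0r subr0 den0 unitr1.
(* Without any level, only the constant term of [D i] is correct; each further level sits under a
   numerator divisible by [x], so it fixes one more coefficient. *)
have TD N i : fps_eqmod N.+1 (contfrac_den num den N i) (D i).
  elim: N i => [|N IHN] i n nN.
    rewrite ltnS leqn0 in nN; rewrite (eqP nN) DE.
    by rewrite coef_fpsD coef_fpsN coef0_fpsM num0 mul0r subr0.
  rewrite DE [contfrac_den _ _ _ _]/= !coef_fpsD !coef_fpsN; congr (_ - _).
  by apply: (fps_eqmodMl_coef0 (num0 i) _ nN); apply: fps_eqmodV.
move=> n; exists n => m nm; rewrite /contfrac_trunc mul1r.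
by apply: (fps_eqmodV (T0 _ _) (D0 _) (TD m 0%N)).
Qed.

End FpsCongruence.

(** * Step-by-step recurrence for path completions, and first passage *)

Section Completions.
Variables P V : set nat.

(** A valley or a peak has the height before its first step [s]; as [s] ends at [h], this is [h.+1]
    for a valley and [h.-1] for a peak. *)
Definition up_ok h s := (s == Up) || (s == Flat) || (h.+1 \in V).
Definition down_ok h s := (s == Flat) || (s == Down) || (h.-1 \in P).

(* Number of ways to extend by [n] steps a path at height [h] whose last step
   is [s], staying at height at least [b] and ending at height [b]. *)
Fixpoint completions b h s n : int :=
  if n is m.+1 then
    (if up_ok h s then completions b h.+1 Up m else 0)
    + completions b h Flat m
    + (if (b < h)%N && down_ok h s then completions b h.-1 Down m else 0)
  else (h == b)%:R.

Definition completion_series b h s : fps int := Fps (completions b h s).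
Local Notation E := completion_series.

Lemma completion_seriesE b h s :
  E b h s = (h == b)%:R + 'x * ((up_ok h s)%:R * E b h.+1 Up + E b h Flat
    + ((b < h)%N && down_ok h s)%:R * E b h.-1 Down).
Proof.
apply/fpsP => n; rewrite coef_fpsD coef_fpsXM.
have -> : ((h == b)%:R : fps int) n = ((h == b) && (n == 0%N))%:R.
  by case: (h == b).
case: n => [|n]; first by rewrite andbT addr0.
by rewrite andbF add0r !coef_fpsD !coef_fpsMb.
Qed.

(* Decomposition at the first passage through [b]; the Down step that leaves
   [b.+1] completes a peak only when it comes first, right after an Up step. *)
Lemma first_passage b h s : (b < h)%N ->
  E b h s = (E b.+1 h s - ((h == b.+1) && ~~ down_ok h s)%:R) * 'x * E b b Down.
Proof.
pose X h s :=
  (E b.+1 h s - ((h == b.+1) && ~~ down_ok h s)%:R) * 'x * E b b Down.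
(* The right-hand side obeys the recurrence of [E b], so coefficients agree by induction. At
   [k = b.+1] the series [E b.+1] has no Down term: its summand 1 for the empty path, less the
   correction, leaves exactly [down_ok]. *)
have XE k t : (b < k)%N -> X k t = 'x * ((up_ok k t)%:R * X k.+1 Up + X k Flat
    + (down_ok k t)%:R * (if k == b.+1 then E b b Down else X k.-1 Down)).
  move=> bk; rewrite {1}/X completion_seriesE /X eqSS (gtn_eqF bk) /= !andbF.
  case: eqVneq => [->|kb]; last by rewrite ltn_neqAle eq_sym kb bk /=; ring.
  by rewrite ltnn; case: (down_ok b.+1 t) => /=; ring.
move=> bh; apply/fpsP => n; elim: n h s bh => [|n IHn] h s bh.
  by rewrite -/(X h s) XE // completion_seriesE (gtn_eqF bh) add0r !coef_fpsXM.
rewrite -/(X h s) XE // completion_seriesE (gtn_eqF bh) bh add0r !coef_fpsXM.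
rewrite !coef_fpsD !coef_fpsMb IHn ?(ltn_trans bh) // IHn //.
rewrite andTb; case: (down_ok h s) => //; congr (_ + _).
case: eqVneq => [-> //|hb]; apply: IHn.
by case: h bh hb => // h; rewrite ltnS leq_eqVlt eqSS eq_sym => /orP[->|].
Qed.

(** A preceding Up step restricts only a Down step, which is impossible at the bottom. *)
Lemma completion_series_bottom_Up b : E b b Up = E b b Flat.
Proof. by rewrite completion_seriesE [RHS]completion_seriesE ltnn. Qed.

(** * Excursions, arches and one level of the continued fraction *)

Definition excursions i : fps int := E i i Flat.

Lemma coef0_excursions i : excursions i 0%N = 1.
Proof. by rewrite /= eqxx. Qed.

Lemma excursions_unit i : excursions i \is a GRing.unit.
Proof. by rewrite fps_unitE coef0_excursions unitr1. Qed.

Definition arches i : fps int :=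
  'x ^+ 2 * (excursions i.+1 - (i \notin P)%:R).

(** Cut at the first step: an Up step opens an arch, and what follows the arch is counted by
    [E i i Down]. After a Down step, a new arch creates a valley at height [i.+1]. *)
Lemma excursions_system i :
  excursions i = 1 + 'x * excursions i + arches i * E i i Down
  /\ E i i Down
     = 1 + 'x * excursions i + (i.+1 \in V)%:R * arches i * E i i Down.
Proof.
have Up1 : E i i.+1 Up = (excursions i.+1 - (i \notin P)%:R) * 'x * E i i Down.
  rewrite first_passage // completion_series_bottom_Up eqxx.
  by rewrite /down_ok /= -/(excursions _).
split; [rewrite {1}/excursions|]; rewrite {1}completion_seriesE eqxx ltnn Up1.
all: rewrite /up_ok /= /arches -/(excursions i); ring.
Qed.

Lemma excursions_valley i : i.+1 \in V ->
  excursions i = 1 + 'x * excursions i + arches i * excursions i.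
Proof.
move=> iV; have [eE] := excursions_system i.
by rewrite iV mul1r -eE => dE; rewrite dE in eE.
Qed.

(** At most one arch can precede the first flat step or the end. *)
Lemma excursions_no_valley i : i.+1 \notin V ->
  excursions i = (1 + 'x * excursions i) * (1 + arches i).
Proof.
move=> /negbTE iV; have [eE] := excursions_system i.
by rewrite iV !mul0r addr0 => dE; rewrite {1}eE dE; ring.
Qed.

Lemma coef0_C1 i : C1 P V i 0%N = 0.
Proof.
by rewrite /C1; do 2?case: ifP; rewrite ?expr2 -?mulrA ?coef0_fpsM ?mul0r.
Qed.

Lemma coef0_C2 i : C2 P V i 0%N = 0.
Proof.
by rewrite /C2; do 2?case: ifP; rewrite ?expr2 -?mulrA ?coef0_fpsM ?mul0r.
Qed.

Lemma coef0_C3 i : C3 P V i 0%N = 0.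
Proof. by rewrite /C3; case: ifP; rewrite ?exprS -?mulrA ?coef0_fpsM ?mul0r. Qed.

Lemma excursionsV i :
  (excursions i)^-1 = 1 - 'x + C1 P V i
    - ('x + C3 P V i) ^+ 2 / ((excursions i.+1)^-1 + C2 P V i.+1).
Proof.
have := coef0_C2 i.+1; have aU := excursions_unit i.+1.
have := @excursions_no_valley i; have := @excursions_valley i.
rewrite /arches; have eU := excursions_unit i; move: aU eU.
set e := excursions i; set a := excursions i.+1; set c2 := C2 _ _ _.
set c1 := C1 _ _ _; set c3 := C3 _ _ _ => aU eU eV enV c20.
have uU : 1 + c2 * a \is a GRing.unit.
  by rewrite fps_unitE coef_fpsD coef0_fpsM c20 mul0r addr0 unitr1.
(* The claim with the denominators [e], [a] and [1 + c2 * a] cleared. *)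
suff eqn : e * ((1 - 'x + c1) * (1 + c2 * a) - ('x + c3) ^+ 2 * a) = 1 + c2 * a.
  have -> : a^-1 + c2 = (1 + c2 * a) / a by rewrite mulrDl mulrK // mul1r.
  rewrite invrM ?unitrV // invrK; apply: (mulrI eU); rewrite mulrV //.
  apply: (mulIr uU); rewrite mul1r -[LHS]eqn -[RHS]mulrA; congr (_ * _).
  by rewrite [RHS]mulrBl -!mulrA mulVr // mulr1.
apply/eqP; rewrite -subr_eq0; apply/eqP; rewrite {uU c20}/c1 {}/c2 {}/c3.
have xU : 1 - 'x ^+ 2 \is a GRing.unit.
  by rewrite fps_unitE coef_fpsD coef_fpsN expr2 coef0_fpsM mul0r subr0 unitr1.
rewrite /C1 /C2 /C3 /=; case iV: (i.+1 \in V) eV enV; case iP: (i \in P) => /=.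
- by move=> /(_ isT) eE _; rewrite -[RHS](subrr e) [in X in _ = _ - X]eE; ring.
- by move=> /(_ isT) eE _; rewrite -[RHS](subrr e) [in X in _ = _ - X]eE; ring.
- by move=> _ /(_ isT) eE; rewrite -[RHS](subrr e) [in X in _ = _ - X]eE; ring.
move=> _ /(_ isT) eE; set r := (1 - 'x ^+ 2)^-1.
have r0 : r * (1 - 'x ^+ 2) - 1 = 0 by rewrite mulVr // subrr.
have -> : 'x ^+ 3 / (1 - 'x ^+ 2) = 'x * (r - 1).
  by apply: (mulIr xU); rewrite mulrVK // -mulrA mulrBl mulVr //; ring.
have -> : 'x ^+ 2 / (1 - 'x ^+ 2) = r - 1.
  by apply: (mulIr xU); rewrite mulrVK // mulrBl mulVr //; ring.
(* Since [ring] treats [r] as a free variable, the difference is written as a combination of two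
   vanishing terms: the equation for [e] and the relation defining [r]. *)
transitivity (r * (e - (1 + 'x * e) * (1 + 'x ^+ 2 * (a - 1)))
    + (e * (r - 'x) * (a - 1) - (a - 1) + e * r) * (r * (1 - 'x ^+ 2) - 1)).
  by ring.
by rewrite r0 -eE subrr !mulr0 addr0.
Qed.

End Completions.

(** * Counting paths by their first step *)

Lemma card_tuple_cons (T : finType) n (q : pred (seq T)) :
  #|[set w : n.+1.-tuple T | q w]|
  = (\sum_(c : T) #|[set w : n.-tuple T | q (c :: w)]|)%N.
Proof.
under [RHS]eq_bigr do rewrite -sum1dep_card.
rewrite pair_big_dep -sum1dep_card.
rewrite (reindex (fun p : T * n.-tuple T => cons_tuple p.1 p.2)) //.
exists (fun w : n.+1.-tuple T => (thead w, behead_tuple w)) => [[c w] _|w _].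
  by rewrite /= theadE; congr (_, _); apply: val_inj.
by rewrite [RHS]tuple_eta; apply: val_inj.
Qed.

Lemma card_set_andb (T : finType) (b : bool) (q : pred T) :
  #|[set x | b && q x]| = (if b then #|[set x | q x]| else 0)%N.
Proof.
by case: b => //; rewrite -(cards0 T); apply: eq_card => x; rewrite !inE.
Qed.

Section Counting.
Variables P V : set nat.
Implicit Types (w : seq step) (s c : step) (h : int).

Definition motzkin_from h w :=
  all (fun k => 0 <= h + height w k) (iota 0 (size w).+1)
  && (h + height w (size w) == 0).

Definition occurs_from u (A : set nat) h w :=
  all (fun k => occurs_at u w k ==> (absz (h + height w k) \in A))
      (iota 0 (size w)).

Lemma height_cons c w k : height (c :: w) k.+1 = step_val c + height w k.
Proof. by rewrite /height /= big_cons. Qed.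

Lemma height0 w : height w 0 = 0.
Proof. by rewrite /height take0 big_nil. Qed.

Lemma motzkin_from_cons h c w :
  motzkin_from h (c :: w) = (0 <= h) && motzkin_from (h + step_val c) w.
Proof.
rewrite /motzkin_from -[iota 0 (size (c :: w)).+1]/(0%N :: iota 1 (size w).+1).
rewrite [iota 1 _](iotaDl 1 0) -(cat1s 0%N) all_cat all_seq1 all_map.
rewrite height0 addr0 height_cons addrA -andbA.
congr (_ && (_ && _)); apply: eq_all => k /=.
by rewrite height_cons addrA.
Qed.

Lemma occurs_from_cons u A h c w : occurs_from u A h (c :: w) =
  (occurs_at u (c :: w) 0 ==> (absz h \in A))
  && occurs_from u A (h + step_val c) w.
Proof.
rewrite /occurs_from -[iota 0 (size (c :: w))]/(0%N :: iota 1 (size w)).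
rewrite [iota 1 _](iotaDl 1 0) -(cat1s 0%N) all_cat all_seq1 all_map.
rewrite height0 addr0.
congr (_ && _); apply: eq_all => k /=.
by rewrite height_cons addrA.
Qed.

(* The step [s] leading to height [h] is prepended to [w] because it may form a
   peak or a valley with the first step of [w]. *)
Definition pv_path_from h s w :=
  [&& motzkin_from h w,
      occurs_from [:: Up; Down] P (h - step_val s) (s :: w)
    & occurs_from [:: Down; Up] V (h - step_val s) (s :: w)].

Lemma pv_path_from_nil (h : nat) s : pv_path_from h s [::] = (h == 0%N).
Proof.
rewrite /pv_path_from /motzkin_from /= !height0 !addr0 lez_nat /= eqz_nat.
by rewrite !occurs_from_cons /occurs_from; case: s; rewrite /= ?andbT.
Qed.

(** The three cases match the three summands of [completions] with [b = 0]. *)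
Lemma pv_path_from_cons (h : nat) s c w : pv_path_from h s (c :: w) =
  match c with
  | Up => up_ok V h s && pv_path_from h.+1 Up w
  | Flat => pv_path_from h Flat w
  | Down => [&& (0 < h)%N, down_ok P h s & pv_path_from h.-1 Down w]
  end.
Proof.
rewrite /pv_path_from motzkin_from_cons.
rewrite !(occurs_from_cons _ _ _ s) !subrK /up_ok /down_ok.
(* This rejects a Down step taken at height 0. *)
have N1 : motzkin_from (-1) w = false.
  by rewrite /motzkin_from /= height0.
have S1 (k : nat) : k%:Z + 1 = k.+1 by rewrite -addn1 PoszD.
have B1 (k : nat) : k.+1%:Z - 1 = k by rewrite -S1 addrK.
case: c; last 2 first.
- by case: s; rewrite /= /occurs_at /= ?take0 ?addr0 ?subr0.
- rewrite opprK; case: h => [|h]; rewrite ?sub0r /= ?N1 ?B1 ?S1 //.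
  case: s; rewrite /= /occurs_at /= ?take0 ?subn1 //=.
  by case: (_ \in P); rewrite ?andbF.
rewrite /= S1 B1; case: s; rewrite /= /occurs_at /= ?take0 ?addn1 //.
by case: (_ \in V); rewrite /= ?andbF.
Qed.

(** A fictitious initial flat step belongs to no peak and no valley. *)
Lemma motzkin_pvE w :
  [&& motzkin w, peaks_in P w & valleys_in V w] = pv_path_from 0 Flat w.
Proof.
rewrite /pv_path_from !(occurs_from_cons _ _ _ Flat) /= subr0 addr0.
rewrite /motzkin /motzkin_from /peaks_in /valleys_in /occurs_from.
rewrite /occurs_at_heights_in !add0r; congr [&& _ && _, _ & _].
all: by apply: eq_all => k; rewrite add0r.
Qed.

Lemma card_pv_path_from n (h : nat) s :
  #|[set w : n.-tuple step | pv_path_from h s w]|%:Z = completions P V 0 h s n.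
Proof.
elim: n h s => [|n IHn] h s.
  rewrite /= -(pv_path_from_nil h s).
  case: (boolP (pv_path_from h s [::])) => q.
    have -> : [set w : 0.-tuple step | pv_path_from h s w] = [set: 0.-tuple step].
      by apply/setP => w; rewrite !inE tuple0.
    by rewrite cardsT card_tuple.
  have -> : [set w : 0.-tuple step | pv_path_from h s w] = finset.set0.
    by apply/setP => w; rewrite !inE tuple0 (negbTE q).
  by rewrite cards0.
rewrite card_tuple_cons (bigD1 Up) // (bigD1 Flat) // (bigD1 Down) //=.
rewrite big1 ?addn0 => [|[]//].
have cardE c (b : bool) (q : pred (seq step)) :
    (forall w, pv_path_from h s (c :: w) = b && q w) ->
  #|[set w : n.-tuple step | pv_path_from h s (c :: w)]|
  = (if b then #|[set w : n.-tuple step | q w]| else 0)%N.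
  by move=> cq; rewrite -card_set_andb; apply: eq_card => w; rewrite !inE cq.
rewrite (cardE _ _ _ (pv_path_from_cons h s Up)).
rewrite (cardE _ true _ (pv_path_from_cons h s Flat)).
rewrite (cardE Down ((0 < h)%N && down_ok P h s) (pv_path_from h.-1 Down)).
  rewrite addnA !PoszD -!IHn.
  by congr (_ + _ + _); case: ifP.
by move=> w; rewrite pv_path_from_cons andbA.
Qed.

End Counting.

Local Open Scope classical_set_scope.

Theorem theorem16 (P V : set nat) (hV : V `<=` [set i | (0 < i)%N]) :
  is_contfrac
    (fun i => ('x + C3 P V i) ^+ 2)
    (fun i => if i == 0%N then 1 - 'x + C1 P V 0
              else 1 - 'x + C1 P V i + C2 P V i)
    (F_pv P V).
Proof.
pose D i := (excursions P V i)^-1 + (if i == 0%N then 0 else C2 P V i).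
have -> : F_pv P V = (D 0%N)^-1.
  rewrite /D addr0 invrK; apply/fpsP => n /=; rewrite -card_pv_path_from.
  by congr Posz; apply: eq_card => w; rewrite !inE motzkin_pvE.
apply: is_contfrac_tails => i.
- by rewrite expr2 coef0_fpsM coef_fpsD coef0_C3 mul0r.
- by case: ifP => _; rewrite !coef_fpsD coef_fpsN ?coef0_C1 ?coef0_C2.
rewrite /D excursionsV /=; case: eqP => [->|_]; first by rewrite addr0.
by rewrite addrAC.
Qed.
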